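(* Let $M$ be a highest weight $\mathfrak{gl}_N$-module and let $\boldsymbol\omega=(\omega_k(M))_{k\in\mathbb N}$. Then the assignment $A\mapsto M\otimes V^{\otimes A}$ on objects, together with $s_i,e_i,\hat s_i,\hat e_i,y_i\mapsto$ the operators defined below, defines a functor from $\underline{\mathrm{VB}}_{r,t}(\boldsymbol\omega)$ to the category of $\mathfrak{gl}_N$-modules (all operators are $\mathfrak{gl}_N$-homomorphisms). In particular, for every $A\in\mathrm{Seq}_{r,t}$ the algebra $\mathrm{VB}_A(\boldsymbol\omega)$ acts on $M\otimes V^{\otimes A}$ by $\mathfrak{gl}_N$-module endomorphisms.
   Context: Let $r,t\in\mathbb N$. An $(r,t)$-sequence is a sequence $A=(a_1,\dots,a_{r+t})$ that is a permutation of $(1,\dots,1,-1,\dots,-1)$ ($r$ entries $1$, $t$ entries $-1$); $\mathrm{Seq}_{r,t}$ is the set of these, and the simple transpositions $\mathsf s_j=(j,j+1)$ of $S_{r+t}$ act on it by permuting entries. Fix complex numbers $\boldsymbol\omega=(\omega_k)_{k\in\mathbb N}$. The degenerate affine walled Brauer category $\underline{\mathrm{VB}}_{r,t}(\boldsymbol\omega)$ is the $\mathbb C$-linear category with object set $\mathrm{Seq}_{r,t}$ whose morphisms are generated by: endomorphisms $s_i^{(A)}$ of $A$ for $1\le i\le r+t-1$ with $a_i=a_{i+1}$; endomorphisms $e_i^{(A)}$ of $A$ for $1\le i\le r+t-1$ with $a_i\neq a_{i+1}$; endomorphisms $y_i^{(A)}$ of $A$ for $1\le i\le r+t$; and morphisms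 $\hat s_j^{(A)},\hat e_j^{(A)}:A\to\mathsf s_jA$ whenever $\mathsf s_jA\ne A$. Superscripts are usually omitted; composition $fg$ means $g$ first. A symbol $\dot s_i$ stands for $s_i$ or $\hat s_i$ and $\dot e_i$ for $e_i$ or $\hat e_i$; each relation is imposed for all objects and all choices of dotted symbols (possibly different on the two sides) for which both sides are defined morphisms with the same source and target. Relations: (1) $\dot s_i\dot s_i=1$; (2) $\dot s_i\dot s_j=\dot s_j\dot s_i$ for $|i-j|>1$, $\dot s_i\dot s_{i+1}\dot s_i=\dot s_{i+1}\dot s_i\dot s_{i+1}$, $\dot s_iy_j=y_j\dot s_i$ for $j\ne i,i+1$; (3) $(e_i^{(A)})^2=\omega_0e_i^{(A)}$; (4) $e_1^{(A)}y_1^ke_1^{(A)}=\omega_ke_1^{(A)}$ for all $k\in\mathbb N$ when $a_1=1,a_2=-1$; (5) $\dot s_i\dot e_j=\dot e_j\dot s_i$ and $\dot e_i\dot e_j=\dot e_j\dot e_i$ for $|i-j|>1$, $\dot e_iy_j=y_j\dot e_i$ for $j\neq i,i+1$, $y_iy_j=y_jy_i$; (6) $\hat s_i\dot e_i=\dot e_i=\dot e_i\hat s_i$, $\dot s_i\dot e_{i+1}\dot e_i=\dot s_{i+1}\dot e_i$, $\dot e_i\dot e_{i+1}\dot s_i=\dot e_i\dot s_{i+1}$, $\dot e_{i+1}\dot e_i\dot s_{i+1}=\dot e_{i+1}\dot s_i$, $\dot s_{i+1}\dot e_i\dot e_{i+1}=\dot s_i\dot e_{i+1}$, $\dot e_{i+1}\dot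 e_i\dot e_{i+1}=\dot e_{i+1}$, $\dot e_i\dot e_{i+1}\dot e_i=\dot e_i$; (7) $s_iy_i-y_{i+1}s_i=-1$, $s_iy_{i+1}-y_is_i=1$, $\hat s_iy_i-y_{i+1}\hat s_i=\hat e_i$, $\hat s_iy_{i+1}-y_i\hat s_i=-\hat e_i$; (8) $\dot e_i(y_i+y_{i+1})=0=(y_i+y_{i+1})\dot e_i$. $\mathrm{VB}_A(\boldsymbol\omega):=\operatorname{End}(A)$. $\mathfrak{gl}_N$ data: $I=\{1,\dots,N\}$, $E_{ij}$ matrix units, $\mathfrak n^+$ strictly upper triangular matrices; a highest weight module is one generated by an $\mathfrak h$-weight vector (for the diagonal Cartan $\mathfrak h$) annihilated by $\mathfrak n^+$. $V=\mathbb C^N$ with basis $v_i$, $E_{ij}v_k=\delta_{jk}v_i$; $V^*$ with dual basis $v_i^*$, $E_{ij}v_k^*=-\delta_{ik}v_j^*$. $V^{\otimes A}=V^{a_1}\otimes\cdots\otimes V^{a_{r+t}}$, $V^1=V$, $V^{-1}=V^*$; factors of $M\otimes V^{\otimes A}$ numbered $0,\dots,r+t$ with $M$ at $0$. For $W\in\{V,V^*\}$ write $(w_p,w_p^* )=(v_p,v_p^* )$ if $W=V$ and $(v_p^*,v_p)$ if $W=V^*$. Operators: $s_i$ (if $a_i=a_{i+1}$) and $\hat s_i:M\otimes V^{\otimes A}\to M\otimes V^{\otimes\mathsf s_iA}$ (if $a_i\ne a_{i+1}$) act by the flip $x\otimes y\mapsto y\otimes x$ on factors $i,i+1$; for $a_i\ne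 a_{i+1}$ and $W=V^{a_i}$, $e_i$ acts on factors $i,i+1$ by $w_p\otimes w_q^*\mapsto\delta_{pq}\sum_{k\in I}w_k\otimes w_k^*$ and $\hat e_i:M\otimes V^{\otimes A}\to M\otimes V^{\otimes\mathsf s_iA}$ by $w_p\otimes w_q^*\mapsto\delta_{pq}\sum_{k\in I}w_k^*\otimes w_k$; all other factors are fixed. With $\Omega=\sum_{i,j}E_{ij}\otimes E_{ji}$ and $\Omega_{kl}$ its action on factors $k<l$, $y_i=\sum_{0\le k<i}\Omega_{ki}+\frac N2$. For a highest weight module $M$, $\omega_k(M)$ is the scalar by which the composite $M\to M\otimes V\otimes V^*\xrightarrow{y_1^k}M\otimes V\otimes V^*\to M$ acts, the first map being $m\mapsto\sum_jm\otimes v_j\otimes v_j^*$ and the last $m\otimes v_i\otimes v_j^*\mapsto\delta_{ij}m$ (this composite is a scalar multiple of the identity). *)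

(* Defs.v *)
(* Conventions.
   - positions of tensor factors are 0-based ordinals 'I_n (paper factor k  <->  ordinal k-1);
     factor 0 of the paper (the module M) is treated separately;
   - an adjacent pair (paper i, i+1), 1 <= i <= n-1, is an ordinal i : 'I_n.-1 (value i-1),
     with left/right positions posL i, posR i : 'I_n;
   - a sign sequence A in Seq_{r,t} is a {ffun 'I_(r+t) -> bool}, true = 1 (factor V),
     false = -1 (factor V^* );
   - M (x) V^{(x)A} is represented, via the tensor basis w_{p_1} (x) ... (x) w_{p_n}
     (w = v or v^* according to A), as coefficient functions  Idx n -> M,
     Idx n = {ffun 'I_n -> 'I_N} (multi-indices): x <-> sum_p x(p) (x) w_p. *)
From HB Require Import structures.
From mathcomp Require Import all_boot all_order all_algebra.
Set Implicit Arguments.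
Unset Strict Implicit.
Unset Printing Implicit Defensive.
Import Order.TTheory GRing.Theory Num.Theory.
Local Open Scope ring_scope.

Lemma posR_subproof n (i : 'I_n.-1) : (i.+1 < n)%N.
Proof. by case: n i => [|n] [i hi]. Qed.

Definition posL n (i : 'I_n.-1) : 'I_n := widen_ord (leq_pred n) i.
Definition posR n (i : 'I_n.-1) : 'I_n := Ordinal (posR_subproof i).

Definition swap_pos n (i : 'I_n.-1) (j : 'I_n) : 'I_n :=
  if j == posL i then posR i else if j == posR i then posL i else j.

Definition far n (i j : 'I_n.-1) : bool := ((i.+1 < j) || (j.+1 < i))%N.
Definition next n (i j : 'I_n.-1) : Prop := val j = (val i).+1.

Definition isSeq r t (A : {ffun 'I_(r + t) -> bool}) : Prop := #|[pred j | A j]| = r.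
Definition swapA n (i : 'I_n.-1) (A : {ffun 'I_n -> bool}) : {ffun 'I_n -> bool} :=
  [ffun j => A (swap_pos i j)].

Section Ops.
Variables (R : numClosedFieldType) (N : nat) (M : lmodType R).
Variable rho : 'I_N -> 'I_N -> M -> M.   (* rho a b = action of E_ab on M *)

Definition is_linear (f : M -> M) : Prop :=
  forall (c : R) (x y : M), f (c *: x + y) = c *: f x + f y.

Definition gl_module : Prop :=
  (forall a b, is_linear (rho a b)) /\
  (forall a b c d m, rho a b (rho c d m) - rho c d (rho a b m) =
     (if b == c then rho a d m else 0) - (if d == a then rho c b m else 0)).

Definition generates (m0 : M) : Prop :=
  forall S : M -> Prop, S m0 ->
    (forall (c : R) x y, S x -> S y -> S (c *: x + y)) ->
    (forall a b x, S x -> S (rho a b x)) -> forall m, S m.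

Definition highest_weight_module : Prop :=
  exists (m0 : M) (lam : 'I_N -> R),
    (forall a, rho a a m0 = lam a *: m0) /\
    (forall a b : 'I_N, (a < b)%N -> rho a b m0 = 0) /\
    generates m0.

Definition Idx n := {ffun 'I_n -> 'I_N}.
Definition Tens n := Idx n -> M.

Definition updq n (q : Idx n) (k : 'I_n) (b : 'I_N) : Idx n :=
  [ffun j => if j == k then b else q j].
Definition swapq n (i : 'I_n.-1) (q : Idx n) : Idx n := [ffun j => q (swap_pos i j)].

Definition flip n (i : 'I_n.-1) (x : Tens n) : Tens n := fun q => x (swapq i q).

(* e_i / hat e_i : w_p (x) w_q^* |-> delta_pq sum_k w_k (x) w_k^*  (resp. w_k^* (x) w_k) *)
Definition cup n (i : 'I_n.-1) (x : Tens n) : Tens n := fun q =>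
  if q (posL i) == q (posR i)
  then \sum_(k < N) x (updq (updq q (posL i) k) (posR i) k) else 0.

Definition actF n (A : {ffun 'I_n -> bool}) (l : 'I_n) (a b : 'I_N) (x : Tens n) : Tens n :=
  fun q => if A l then (if q l == a then x (updq q l b) else 0)
           else (if q l == b then - x (updq q l a) else 0).

Definition glact n (A : {ffun 'I_n -> bool}) (a b : 'I_N) (x : Tens n) : Tens n :=
  fun q => rho a b (x q) + \sum_(l < n) actF A l a b x q.

(* y_j = sum_{0 <= k < j} Omega_{kj} + N/2  (factor 0 = M) *)
Definition yop n (A : {ffun 'I_n -> bool}) (j : 'I_n) (x : Tens n) : Tens n := fun q =>
  \sum_(a < N) \sum_(b < N) rho a b (actF A j b a x q)
  + \sum_(k < n | (k < j)%N) \sum_(a < N) \sum_(b < N) actF A k a b (actF A j b a x) q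
  + (N%:R / 2%:R) *: x q.

(* omega_k(M) : M -> M (x) V (x) V^* --y_1^k--> M (x) V (x) V^* -> M *)
Definition A2 : {ffun 'I_2 -> bool} := [ffun j => j == ord0].
Definition coev (m : M) : Tens 2 := fun q => if q ord0 == q ord_max then m else 0.
Definition ev (x : Tens 2) : M := \sum_(i < N) x [ffun _ => i].
Definition is_omega (omega : nat -> R) : Prop :=
  forall (k : nat) (m : M), ev (iter k (yop A2 ord0) (coev m)) = omega k *: m.

Definition is_hom n (A B : {ffun 'I_n -> bool}) (f : Tens n -> Tens n) : Prop :=
  forall a b (x : Tens n) q, f (glact A a b x) q = glact B a b (f x) q.

Definition ops_are_homs (r t : nat) : Prop :=
  forall A : {ffun 'I_(r + t) -> bool}, isSeq A ->
    (forall i : 'I_(r + t).-1, is_hom A (swapA i A) (flip i)) /\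
    (forall i : 'I_(r + t).-1, A (posL i) != A (posR i) ->
        is_hom A A (cup i) /\ is_hom A (swapA i A) (cup i)) /\
    (forall j : 'I_(r + t), is_hom A A (yop A j)).

(* the defining relations (1)-(8) of VB_{r,t}(omega), for every object A and
   every admissible choice of dotted symbols *)
Definition VB_relations (r t : nat) (omega : nat -> R) : Prop :=
  forall A : {ffun 'I_(r + t) -> bool}, isSeq A ->
  (forall (i : 'I_(r + t).-1) (x : Tens (r + t)) q, flip i (flip i x) q = x q) /\
  (forall (i j : 'I_(r + t).-1) (x : Tens (r + t)) q, far i j -> flip i (flip j x) q = flip j (flip i x) q) /\
  (forall (i j : 'I_(r + t).-1) (x : Tens (r + t)) q, next i j ->
     flip i (flip j (flip i x)) q = flip j (flip i (flip j x)) q) /\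
  (forall (i : 'I_(r + t).-1) (j : 'I_(r + t)) (x : Tens (r + t)) q, j != posL i -> j != posR i ->
     flip i (yop A j x) q = yop (swapA i A) j (flip i x) q) /\
  (forall (i : 'I_(r + t).-1) (x : Tens (r + t)) q, A (posL i) != A (posR i) ->
     cup i (cup i x) q = omega 0%N *: cup i x q) /\
  (forall (i : 'I_(r + t).-1) (k : nat) (x : Tens (r + t)) q, val i = 0%N -> A (posL i) -> ~~ A (posR i) ->
     cup i (iter k (yop A (posL i)) (cup i x)) q = omega k *: cup i x q) /\
  (forall (i j : 'I_(r + t).-1) (x : Tens (r + t)) q, far i j -> A (posL j) != A (posR j) ->
     flip i (cup j x) q = cup j (flip i x) q) /\
  (forall (i j : 'I_(r + t).-1) (x : Tens (r + t)) q, far i j -> A (posL i) != A (posR i) -> A (posL j) != A (posR j) ->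
     cup i (cup j x) q = cup j (cup i x) q) /\
  (forall (i : 'I_(r + t).-1) (j : 'I_(r + t)) (B : {ffun 'I_(r + t) -> bool}) (x : Tens (r + t)) q, j != posL i -> j != posR i -> A (posL i) != A (posR i) ->
     (B = A \/ B = swapA i A) ->
     cup i (yop A j x) q = yop B j (cup i x) q) /\
  (forall (i j : 'I_(r + t)) (x : Tens (r + t)) q, yop A i (yop A j x) q = yop A j (yop A i x) q) /\
  (forall (i : 'I_(r + t).-1) (x : Tens (r + t)) q, A (posL i) != A (posR i) -> flip i (cup i x) q = cup i x q) /\
  (forall (i : 'I_(r + t).-1) (x : Tens (r + t)) q, A (posL i) != A (posR i) -> cup i (flip i x) q = cup i x q) /\
  (forall (i j : 'I_(r + t).-1) (x : Tens (r + t)) q, next i j -> A (posL i) != A (posR i) ->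
     flip i (cup j (cup i x)) q = flip j (cup i x) q) /\
  (forall (i j : 'I_(r + t).-1) (x : Tens (r + t)) q, next i j -> A (posL i) != A (posR j) ->
     cup i (cup j (flip i x)) q = cup i (flip j x) q) /\
  (forall (i j : 'I_(r + t).-1) (x : Tens (r + t)) q, next i j -> A (posL i) != A (posR j) ->
     cup j (cup i (flip j x)) q = cup j (flip i x) q) /\
  (forall (i j : 'I_(r + t).-1) (x : Tens (r + t)) q, next i j -> A (posL j) != A (posR j) ->
     flip j (cup i (cup j x)) q = flip i (cup j x) q) /\
  (forall (i j : 'I_(r + t).-1) (x : Tens (r + t)) q, next i j -> A (posL j) != A (posR j) ->
     cup j (cup i (cup j x)) q = cup j x q) /\
  (forall (i j : 'I_(r + t).-1) (x : Tens (r + t)) q, next i j -> A (posL i) != A (posR i) ->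
     cup i (cup j (cup i x)) q = cup i x q) /\
  (forall (i : 'I_(r + t).-1) (x : Tens (r + t)) q, A (posL i) = A (posR i) ->
     flip i (yop A (posL i) x) q - yop A (posR i) (flip i x) q = - x q) /\
  (forall (i : 'I_(r + t).-1) (x : Tens (r + t)) q, A (posL i) = A (posR i) ->
     flip i (yop A (posR i) x) q - yop A (posL i) (flip i x) q = x q) /\
  (forall (i : 'I_(r + t).-1) (x : Tens (r + t)) q, A (posL i) != A (posR i) ->
     flip i (yop A (posL i) x) q - yop (swapA i A) (posR i) (flip i x) q = cup i x q) /\
  (forall (i : 'I_(r + t).-1) (x : Tens (r + t)) q, A (posL i) != A (posR i) ->
     flip i (yop A (posR i) x) q - yop (swapA i A) (posL i) (flip i x) q = - cup i x q) /\
  (forall (i : 'I_(r + t).-1) (x : Tens (r + t)) q, A (posL i) != A (posR i) ->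
     cup i (fun p => yop A (posL i) x p + yop A (posR i) x p) q = 0) /\
  (forall (i : 'I_(r + t).-1) (B : {ffun 'I_(r + t) -> bool}) (x : Tens (r + t)) q, A (posL i) != A (posR i) -> (B = A \/ B = swapA i A) ->
     yop B (posL i) (cup i x) q + yop B (posR i) (cup i x) q = 0).

End Ops.

(* Main.v *)
(* Every factor k of M (x) V^{(x)A} (k = 0 being M) carries its own gl_N-action
   X_k, and the actions on distinct factors commute. The Casimir operator
   Omega_kl = sum_ab X_k(E_ab) X_l(E_ba) commutes with X_k + X_l and with every
   other X_m. Hence y_l = sum_{k<l} Omega_kl + N/2 commutes with the diagonal
   action on any set of factors containing all factors <= l, which shows both
   that y_l is a gl_N-homomorphism and that the y_l commute with each other.
   The relations between y_l and the other generators hold because the flip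
   permutes the X_k, the cup commutes with the X_k for k away from i, i+1, it
   kills X_i + X_{i+1} on both sides, and Omega_{i,i+1} is the flip for equal
   signs and minus the cup for opposite signs. Since y_1 involves only the
   factors 0 and 1, fixing all tensor indices but the first two reduces
   e_1 y_1^k e_1 = omega_k e_1 to the definition of omega_k. *)
Require Import Defs.
From HB Require Import structures.
From mathcomp Require Import all_boot all_order all_algebra.
From mathcomp Require Import boolp functions zify ring.
Set Implicit Arguments.
Unset Strict Implicit.
Unset Printing Implicit Defensive.
Import Order.TTheory GRing.Theory Num.Theory.
Local Open Scope ring_scope.

(** * Casimir operators of pairwise commuting gl_N-actions *)

Section Casimir.

Variables (N : nat) (K : finType) (R : pzRingType) (V : lmodType R).
Implicit Types (k l m : K) (P : pred K) (a b c d : 'I_N) (v : V).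

Definition pairwise_gl (X : K -> 'I_N -> 'I_N -> {linear V -> V}) : Prop :=
  (forall k a b c d v, X k a b (X k c d v) - X k c d (X k a b v) =
     (if b == c then X k a d v else 0) - (if d == a then X k c b v else 0)) /\
  (forall k l, k != l ->
     forall a b c d v, X k a b (X l c d v) = X l c d (X k a b v)).

Variable X : K -> 'I_N -> 'I_N -> {linear V -> V}.

Definition Casimir k l v := \sum_a \sum_b X k a b (X l b a v).
Definition diagonal P a b v := \sum_(k | P k) X k a b v.

Fact Casimir_is_linear k l : linear (Casimir k l).
Proof.
move=> e u v; rewrite /Casimir scaler_sumr -big_split; apply: eq_bigr => a _ /=.
by rewrite scaler_sumr -big_split; apply: eq_bigr => b _; rewrite !linearP.
Qed.
HB.instance Definition _ k l :=
  GRing.isLinear.Build R V V *:%R (Casimir k l) (Casimir_is_linear k l).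

Fact diagonal_is_linear P a b : linear (diagonal P a b).
Proof.
move=> e u v; rewrite /diagonal scaler_sumr -big_split.
by apply: eq_bigr => k _; rewrite linearP.
Qed.
HB.instance Definition _ P a b :=
  GRing.isLinear.Build R V V *:%R (diagonal P a b) (diagonal_is_linear P a b).

Hypothesis X_gl : pairwise_gl X.

Lemma CasimirC k l v : k != l -> Casimir k l v = Casimir l k v.
Proof.
case: X_gl => _ XC kl; rewrite /Casimir exchange_big /=.
by apply: eq_bigr => b _; apply: eq_bigr => a _; rewrite XC.
Qed.

Lemma Casimir_disjoint k l m c d v : k != m -> l != m ->
  Casimir k l (X m c d v) = X m c d (Casimir k l v).
Proof.
case: X_gl => _ XC km lm; rewrite /Casimir raddf_sum; apply: eq_bigr => a _.
by rewrite raddf_sum; apply: eq_bigr => b _; rewrite (XC l m) // (XC k m).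
Qed.

(** Commuting [E_cd] past the two legs of the Casimir sum leaves four single sums. The first cancels
    the fourth and the second cancels the third. *)
Lemma Casimir_invariant k l c d v : k != l ->
  Casimir k l (X k c d v + X l c d v) =
  X k c d (Casimir k l v) + X l c d (Casimir k l v).
Proof.
case: X_gl => Xgl XC kl; apply/eqP.
rewrite -subr_eq0 [Casimir k l _]raddfD /= opprD.
rewrite addrACA /Casimir (raddf_sum (X k c d)) (raddf_sum (X l c d)) /=.
rewrite -!sumrB -big_split /=.
have step a b : X k a b (X l b a (X k c d v)) - X k c d (X k a b (X l b a v)) +
    (X k a b (X l b a (X l c d v)) - X l c d (X k a b (X l b a v))) =
    (if b == c then X k a d (X l b a v) else 0) -
    (if a == d then X k c b (X l b a v) else 0) +
    ((if a == c then X k a b (X l b d v) else 0) -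
     (if b == d then X k a b (X l c a v) else 0)).
  rewrite -(XC k l) // Xgl [d == a]eq_sym; congr (_ + _).
  rewrite -(XC k l) // -raddfB Xgl raddfB [d == b]eq_sym.
  by case: eqP => _; case: eqP => _; rewrite ?raddf0.
have pick1 (F : 'I_N -> V) e : \sum_b (if b == e then F b else 0) = F e.
  by rewrite -big_mkcond big_pred1_eq.
under eq_bigr => a _.
  rewrite (raddf_sum (X k c d)) (raddf_sum (X l c d)) /= -!sumrB -big_split /=.
  under eq_bigr => b _ do rewrite step.
  rewrite big_split /= !sumrB !pick1.
  over.
have pick2 (F : 'I_N -> 'I_N -> V) e :
    \sum_a \sum_b (if a == e then F a b else 0) = \sum_b F e b.
  by rewrite exchange_big; apply: eq_bigr => b _; rewrite pick1.
rewrite big_split /= !sumrB !pick2.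
by rewrite addrC addrACA [- _ - _]addrC addrACA !subrr addr0.
Qed.

(** The summands [k] and [l] of the diagonal action are handled together by invariance; every other
    summand acts on a factor disjoint from both. *)
Lemma Casimir_diagonal P k l c d v : P k -> P l -> k != l ->
  Casimir k l (diagonal P c d v) = diagonal P c d (Casimir k l v).
Proof.
move=> Pk Pl kl; have Plk : P l && (l != k) by rewrite Pl eq_sym.
rewrite /diagonal (bigD1 k) //= (bigD1 l) //= addrA raddfD /=.
rewrite Casimir_invariant // (raddf_sum (Casimir k l)) /= [RHS](bigD1 k) //=.
rewrite [in RHS](bigD1 l) //= -addrA.
congr (_ + (_ + _)); apply: eq_bigr => m /andP[/andP[_ mk] ml].
by rewrite Casimir_disjoint // eq_sym.
Qed.

Lemma Casimir_comm k l m p v : k != m -> l != m -> k != p -> l != p ->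
  Casimir k l (Casimir m p v) = Casimir m p (Casimir k l v).
Proof.
move=> km lm kp lp; rewrite [Casimir m p v]/Casimir (raddf_sum (Casimir k l)).
apply: eq_bigr => a _; rewrite (raddf_sum (Casimir k l)) /=.
by apply: eq_bigr => b _; rewrite !Casimir_disjoint.
Qed.

(** * Jucys-Murphy sums of Casimir operators over an ordered family of factors *)

Section JucysMurphy.

Variable lt : rel K.
Hypotheses (lt_irr : irreflexive lt) (lt_trans : transitive lt).
Hypothesis lt_total : forall k l, k != l -> lt k l || lt l k.

Definition JucysMurphy l v := \sum_(k | lt k l) Casimir k l v.

Fact JucysMurphy_is_linear l : linear (JucysMurphy l).
Proof.
move=> e u v; rewrite /JucysMurphy scaler_sumr -big_split.
by apply: eq_bigr => k _; rewrite linearP.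
Qed.
HB.instance Definition _ l :=
  GRing.isLinear.Build R V V *:%R (JucysMurphy l) (JucysMurphy_is_linear l).

(** With the sum over [k] moved inside, all factors below [l] enter through a single diagonal
    action. In this form a cup at two of those factors can be moved past the operator. *)
Lemma JucysMurphyE l v :
  JucysMurphy l v = \sum_a \sum_b diagonal (lt^~ l) a b (X l b a v).
Proof.
rewrite /JucysMurphy exchange_big; apply: eq_bigr => a _.
by rewrite exchange_big.
Qed.

Lemma lt_neq k l : lt k l -> k != l.
Proof. by apply: contraTneq => ->; rewrite lt_irr. Qed.

Lemma JucysMurphy_diagonal P l c d v : P l -> (forall k, lt k l -> P k) ->
  JucysMurphy l (diagonal P c d v) = diagonal P c d (JucysMurphy l v).
Proof.
move=> Pl ltP; rewrite /JucysMurphy (raddf_sum (diagonal P c d)).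
apply: eq_bigr => k kl /=.
by rewrite Casimir_diagonal //; [exact: ltP | exact: lt_neq].
Qed.

Lemma JucysMurphy_disjoint l m c d v : l != m -> ~~ lt m l ->
  JucysMurphy l (X m c d v) = X m c d (JucysMurphy l v).
Proof.
move=> lm ml; rewrite /JucysMurphy (raddf_sum (X m c d)).
apply: eq_bigr => k kl /=.
by rewrite Casimir_disjoint //; apply: contraNneq ml => <-.
Qed.

(* The k <= l terms of JucysMurphy m assemble into the diagonal action on the
   factors <= l paired with factor m, and JucysMurphy l only involves those
   factors, on which it commutes with the diagonal action. *)
Lemma JucysMurphy_comm_lt l m v : lt l m ->
  JucysMurphy l (JucysMurphy m v) = JucysMurphy m (JucysMurphy l v).
Proof.
move=> lm; have ml : ~~ lt m l.
  by apply/negP => /lt_trans/(_ lm); rewrite lt_irr.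
pose P k := (k == l) || lt k l.
have PlP k : P k -> lt k m by move=> /orP[/eqP->|/lt_trans/(_ lm)].
have split w : JucysMurphy m w = \sum_a \sum_b diagonal P a b (X m b a w)
    + \sum_(k | lt k m && ~~ P k) Casimir k m w.
  rewrite [LHS](bigID P) /=; congr (_ + _).
  rewrite (eq_bigl P) => [|k]; last first.
    by case Pk: (P k); rewrite ?andbF ?andbT ?PlP.
  rewrite exchange_big; apply: eq_bigr => a _.
  by rewrite exchange_big; apply: eq_bigr => b _.
rewrite !split raddfD !raddf_sum /=; congr (_ + _).
  apply: eq_bigr => a _; rewrite raddf_sum; apply: eq_bigr => b _ /=.
  rewrite JucysMurphy_diagonal /P ?eqxx // => [|k ->]; last by rewrite orbT.
  by rewrite JucysMurphy_disjoint ?lt_neq.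
(* In the remaining terms [k] and [m] both lie above [l], hence differ from [l] and from every [p]
   below it, so these Casimir operators have disjoint supports. *)
apply: eq_bigr => k /andP[km]; rewrite negb_or => /andP[kl ltkl].
rewrite /JucysMurphy raddf_sum /=; apply: eq_bigr => p pl.
rewrite Casimir_comm //.
- by apply: contraNneq ltkl => <-.
- by rewrite eq_sym.
- exact/lt_neq/(lt_trans pl).
- exact: lt_neq.
Qed.

Lemma JucysMurphy_comm l m v :
  JucysMurphy l (JucysMurphy m v) = JucysMurphy m (JucysMurphy l v).
Proof.
have [->//|/lt_total/orP[]] := eqVneq l m; first exact: JucysMurphy_comm_lt.
by move=> ml; exact/esym/JucysMurphy_comm_lt.
Qed.

End JucysMurphy.
End Casimir.

(** * Flips and cups at two arbitrary positions *)

Section Positions.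

Variables (R : numClosedFieldType) (N : nat) (M : lmodType R) (n : nat).
Implicit Types (p l j : 'I_n) (q : Idx N n) (x : Tens N M n).
Implicit Types (A B : {ffun 'I_n -> bool}) (a b k : 'I_N).

(** The two positions need not be adjacent or ordered, so a relation and its left-right mirror image
    are instances of one lemma. *)
Definition swap_at p p' j : 'I_n :=
  if j == p then p' else if j == p' then p else j.
Definition flip_at p p' x : Tens N M n := fun q => x [ffun j => q (swap_at p p' j)].
Definition cup_at p p' x : Tens N M n := fun q =>
  if q p == q p' then \sum_k x (updq (updq q p k) p' k) else 0.

Lemma swap_atK p p' : involutive (swap_at p p').
Proof. by move=> j; rewrite /swap_at; do !case: eqP => //; congruence. Qed.

Lemma swap_at_sym p p' : swap_at p p' =1 swap_at p' p.
Proof. by move=> j; rewrite /swap_at; do !case: eqP => //; congruence. Qed.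

Lemma sum_eq (V : nmodType) (F : 'I_N -> V) a :
  \sum_b (if b == a then F b else 0) = F a.
Proof. by rewrite -big_mkcond big_pred1_eq. Qed.

Lemma sum_if (V : nmodType) (F : 'I_N -> V) (c : bool) :
  \sum_b (if c then F b else 0) = if c then \sum_b F b else 0.
Proof. by case: c => //; rewrite big1. Qed.

Lemma sum_eqr (V : nmodType) (F : 'I_N -> V) a :
  \sum_b (if a == b then F b else 0) = F a.
Proof. by under eq_bigr do rewrite eq_sym; apply: sum_eq. Qed.

Lemma opp_if (V : zmodType) (c : bool) (v : V) :
  - (if c then v else 0) = if c then - v else 0.
Proof. by case: c; rewrite ?oppr0. Qed.

Local Ltac idx :=
  apply/ffunP => ?; rewrite ?ffunE /swap_at; repeat case: eqP => //; congruence.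

Lemma updq_id q p b : updq q p b p = b.
Proof. by rewrite ffunE eqxx. Qed.

Lemma updq_neq q p l b : l != p -> updq q p b l = q l.
Proof. by rewrite ffunE => /negPf->. Qed.

Lemma updqC q p l a b : p != l -> updq (updq q p a) l b = updq (updq q l b) p a.
Proof. by move/eqP=> pl; idx. Qed.

Lemma updq_idem q p a b : updq (updq q p a) p b = updq q p b.
Proof. by idx. Qed.

Lemma flip_atC p p' x : flip_at p p' x = flip_at p' p x.
Proof.
by apply/funext => q; congr x; apply/ffunP => j; rewrite !ffunE swap_at_sym.
Qed.

Lemma cup_atC p p' x : cup_at p p' x = cup_at p' p x.
Proof.
have [->//|pp'] := eqVneq p p'; apply/funext => q.
rewrite /cup_at eq_sym; case: ifP => // _.
by apply: eq_bigr => k _; rewrite updqC.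
Qed.

Lemma flip_atK p p' : involutive (flip_at p p').
Proof.
move=> x; apply/funext => q; rewrite /flip_at; congr x.
by apply/ffunP => j; rewrite !ffunE swap_atK.
Qed.

Lemma flip_at_actF A p p' l a b x :
  flip_at p p' (actF A l a b x) =
  actF [ffun j => A (swap_at p p' j)] (swap_at p p' l) a b (flip_at p p' x).
Proof.
have upd q c : updq [ffun j => q (swap_at p p' j)] l c =
    [ffun j => updq q (swap_at p p' l) c (swap_at p p' j)] :> Idx N n.
  by apply/ffunP => j; rewrite !ffunE (can_eq (swap_atK p p')).
by apply/funext => q; rewrite /flip_at /actF !ffunE swap_atK !upd.
Qed.

(** The sign sequences have to agree only at [l]; this treats [e_i] and its hatted version, which
    changes the signs at the cup, at once. *)
Lemma cup_at_actF A B p p' l a b x : l != p -> l != p' -> A l = B l ->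
  cup_at p p' (actF A l a b x) = actF B l a b (cup_at p p' x).
Proof.
move=> lp lp' AB; have pl : p != l by rewrite eq_sym.
have p'l : p' != l by rewrite eq_sym.
apply/funext => q; rewrite /cup_at /actF AB !updq_neq //.
case: (B l); case: (q p == q p') => //; rewrite ?oppr0 ?if_same //;
  case: ifP => eql;  rewrite -?sumrN.
all: try (rewrite big1 // => k _; by rewrite !updq_neq // eql).
all: apply: eq_bigr => k _.
all: by rewrite !updq_neq // eql (updqC _ _ _ p'l) (updqC _ _ _ pl).
Qed.

(** This is the invariance of the evaluation pairing: the two Kronecker deltas select the same
    coefficient of [x], and the dual factor contributes it with a minus sign. *)
Lemma cup_at_actF_pair A p p' a b x : p != p' -> A p != A p' ->
  cup_at p p' (actF A p a b x + actF A p' a b x) = 0.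
Proof.
wlog Ap : p p' / A p => [th pp'|pp'].
  case Ap: (A p) => App'; first by apply: th => //; rewrite Ap.
  have Ap' : A p' by case: (A p') App'.
  by rewrite cup_atC addrC; apply: th; rewrite 1?eq_sym ?Ap ?Ap'.
rewrite Ap; case Ap': (A p') => // _; apply/funext => q.
rewrite /cup_at; case: ifP => // _; rewrite /actF Ap Ap'.
rewrite addrfctE big_split /=.
under eq_bigr => k _ do rewrite updq_neq // updq_id.
under [X in _ + X]eq_bigr => k _ do rewrite updq_id.
rewrite !sum_eq; apply/eqP; rewrite subr_eq0; apply/eqP; congr x.
by move/eqP: pp' => pp'; idx.
Qed.

(** Dually, the image of the cup involves these two factors only through the canonical element of V
    tensor V^*, which is invariant. *)
Lemma actF_cup_at_pair A p p' a b x : p != p' -> A p != A p' ->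
  actF A p a b (cup_at p p' x) + actF A p' a b (cup_at p p' x) = 0.
Proof.
wlog Ap : p p' / A p => [th pp'|pp'].
  case Ap: (A p) => App'; first by apply: th => //; rewrite Ap.
  have Ap' : A p' by case: (A p') App'.
  by rewrite cup_atC addrC; apply: th; rewrite 1?eq_sym ?Ap ?Ap'.
have p'p : p' != p by rewrite eq_sym.
rewrite Ap; case Ap': (A p') => // _; apply/funext => q.
rewrite addrfctE /actF Ap Ap' /cup_at !updq_id !updq_neq //.
rewrite [b == _]eq_sym.
case: eqP => _; case: eqP => _; rewrite ?oppr0; try exact: addr0.
apply/eqP; rewrite subr_eq0; apply/eqP; apply: eq_bigr => k _; congr x.
by move/eqP: pp' => pp'; idx.
Qed.

Lemma sum_actF_flip A p p' x : p != p' -> A p = A p' ->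
  \sum_a \sum_b actF A p a b (actF A p' b a x) = flip_at p p' x.
Proof.
move=> pp' App'; have p'p : p' != p by rewrite eq_sym.
apply/funext => q; rewrite fct_sumE.
under eq_bigr => a _ do rewrite fct_sumE.
have -> : flip_at p p' x q = x (updq (updq q p (q p')) p' (q p)).
  by congr x; move/eqP: pp' => pp'; idx.
(* For two dual factors the two minus signs cancel and [a], [b] trade roles, hence the exchanged
   sums. *)
rewrite /actF -App'; case: (A p); last rewrite exchange_big /=.
  under eq_bigr => a _ do
    (under eq_bigr => b _ do rewrite updq_neq //; rewrite sum_if sum_eqr).
  by rewrite sum_eqr.
under eq_bigr => b _ do (under eq_bigr => a _ do
    rewrite updq_neq // opp_if opprK; rewrite sum_if sum_eqr).
by rewrite sum_eqr.
Qed.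

(** Exactly one of the two factors is dual, so one minus sign survives; both legs test against the
    same matrix index, which produces the delta of the cup. *)
Lemma sum_actF_cup A p p' x : p != p' -> A p != A p' ->
  \sum_a \sum_b actF A p a b (actF A p' b a x) = - cup_at p p' x.
Proof.
move=> pp' App'; have p'p : p' != p by rewrite eq_sym.
apply/funext => q; rewrite fct_sumE.
under eq_bigr => a _ do rewrite fct_sumE.
rewrite opprfctE /cup_at opp_if [q p == _]eq_sym -sumrN.
rewrite /actF; case: (A p) App'; case: (A p') => // _; last rewrite exchange_big /=.
  under eq_bigr => a _ do
    (under eq_bigr => b _ do rewrite updq_neq //; rewrite sum_if).
  by rewrite sum_eqr sum_if.
under eq_bigr => b _ do (under eq_bigr => a _ do
    rewrite updq_neq // opp_if; rewrite sum_if).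
by rewrite sum_eqr sum_if.
Qed.

Lemma cup_at_flip p p' x : p != p' -> cup_at p p' (flip_at p p' x) = cup_at p p' x.
Proof.
move=> /eqP pp'; apply/funext => q; rewrite /cup_at; case: ifP => // _.
by apply: eq_bigr => k _; congr x; idx.
Qed.

Lemma flip_at_cup p p' x : p != p' -> flip_at p p' (cup_at p p' x) = cup_at p p' x.
Proof.
move=> pp'; apply/funext => q; rewrite /flip_at /cup_at !ffunE /swap_at !eqxx.
have p'p : p' != p by rewrite eq_sym.
rewrite (negPf p'p) eq_sym; case: ifP => // _.
by move/eqP: pp' => pp'; apply: eq_bigr => k _; congr x; idx.
Qed.

(** The inner sum does not depend on the outer index, so a closed loop contributes [N]. *)
Lemma cup_atK p p' x : p != p' ->
  cup_at p p' (cup_at p p' x) = N%:R *: cup_at p p' x.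
Proof.
move=> pp'; apply/funext => q; rewrite scalrfctE /cup_at.
case: ifP => _; last by rewrite scaler0.
transitivity (\sum_(k < N) \sum_m x (updq (updq q p m) p' m)); last first.
  by rewrite sumr_const card_ord scaler_nat.
apply: eq_bigr => k _; rewrite updq_neq // !updq_id eqxx; apply: eq_bigr => m _.
by congr x; move/eqP: pp' => pp'; idx.
Qed.

Section ThreePositions.

Variables p p' p'' : 'I_n.
Hypotheses (pp' : p <> p') (pp'' : p <> p'') (p'p'' : p' <> p'').

Let neqs : (((p == p' = false) * (p' == p = false)) * ((p == p'' = false) *
   (p'' == p = false)) * ((p' == p'' = false) * (p'' == p' = false)))%type.
Proof. by do !split; apply/eqP => // /esym. Qed.

Lemma flip_at_braid x : flip_at p p' (flip_at p' p'' (flip_at p p' x)) =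
  flip_at p' p'' (flip_at p p' (flip_at p' p'' x)).
Proof. by apply/funext => q; congr x; idx. Qed.

(** Straightening a zigzag: the delta of one cup collapses the sum of the cup applied after it. The
    two lemmas below rest on the same collapse. *)
Lemma flip_cup_cup x :
  flip_at p p' (cup_at p' p'' (cup_at p p' x)) = flip_at p' p'' (cup_at p p' x).
Proof.
apply/funext => q; rewrite /flip_at /cup_at !ffunE /swap_at !neqs !eqxx.
case: eqP => // _; under eq_bigr => k _ do rewrite !ffunE !neqs !eqxx.
by rewrite sum_eqr; apply: eq_bigr => m _; congr x; idx.
Qed.

Lemma cup_cup_flip x :
  cup_at p p' (cup_at p' p'' (flip_at p p' x)) = cup_at p p' (flip_at p' p'' x).
Proof.
apply/funext => q; rewrite /flip_at /cup_at /swap_at.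
case: eqP => // _; under eq_bigr => k _ do rewrite !ffunE !neqs !eqxx.
by rewrite sum_eq; apply: eq_bigr => m _; congr x; idx.
Qed.

Lemma cup_cup_cup x : cup_at p p' (cup_at p' p'' (cup_at p p' x)) = cup_at p p' x.
Proof.
apply/funext => q; rewrite /cup_at.
case: eqP => // _; under eq_bigr => k _.
  rewrite !ffunE !neqs !eqxx; under eq_bigr => m _ do rewrite !ffunE !neqs !eqxx.
  rewrite sum_eqr; over.
by rewrite sum_eq; apply: eq_bigr => m _; congr x; idx.
Qed.

End ThreePositions.

Section FourPositions.

Variables p p' l l' : 'I_n.
Hypotheses (pl : p <> l) (pl' : p <> l') (p'l : p' <> l) (p'l' : p' <> l').

Let neqs : (((p == l = false) * (l == p = false)) * ((p == l' = false) *
   (l' == p = false)) * ((p' == l = false) * (l == p' = false)) *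
   ((p' == l' = false) * (l' == p' = false)))%type.
Proof. by do !split; apply/eqP => // /esym. Qed.

Lemma flip_flip_far x :
  flip_at p p' (flip_at l l' x) = flip_at l l' (flip_at p p' x).
Proof. by apply/funext => q; congr x; idx. Qed.

Lemma flip_cup_far x : flip_at p p' (cup_at l l' x) = cup_at l l' (flip_at p p' x).
Proof.
apply/funext => q; rewrite /flip_at /cup_at !ffunE /swap_at !neqs.
by case: eqP => // _; apply: eq_bigr => k _; congr x; idx.
Qed.

Lemma cup_cup_far x : cup_at p p' (cup_at l l' x) = cup_at l l' (cup_at p p' x).
Proof.
apply/funext => q; rewrite /cup_at.
under eq_bigr => k _ do rewrite !ffunE !neqs.
under [in RHS]eq_bigr => k _ do rewrite !ffunE !neqs.
rewrite !sum_if; case: eqP => // _; case: eqP => // _.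
rewrite exchange_big; apply: eq_bigr => k _; apply: eq_bigr => m _.
by congr x; idx.
Qed.

End FourPositions.
End Positions.

(** * The factors of the tensor product as commuting gl_N-actions, and the operators y_j *)

Lemma big_option (V : nmodType) (T : finType) (P : pred (option T))
    (F : option T -> V) :
  \sum_(k | P k) F k =
  (if P None then F None else 0) + \sum_(k | P (Some k)) F (Some k).
Proof.
rewrite (perm_big (None :: [seq Some k | k <- index_enum T])) /=.
  by rewrite big_cons big_map; case: (P None); rewrite ?add0r.
apply: uniq_perm; first exact: index_enum_uniq.
- rewrite /= map_inj_uniq ?index_enum_uniq ?andbT; last by move=> ? ? [].
  by apply/mapP => -[].
- move=> [k|]; rewrite mem_index_enum inE //=.
  by rewrite mem_map ?mem_index_enum // => ? ? [].
Qed.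

Section Factors.

Variables (R : numClosedFieldType) (N : nat) (M : lmodType R) (n : nat).
Variable rho : 'I_N -> 'I_N -> M -> M.
Hypothesis rho_gl : gl_module rho.
Implicit Types (x : Tens N M n) (A B : {ffun 'I_n -> bool}).

(* [None] is the factor M, [Some l] the l-th factor of V^{(x)A} *)
Definition factor A (k : option 'I_n) a b x : Tens N M n :=
  if k is Some l then actF A l a b x else fun q => rho a b (x q).

HB.instance Definition _ a b :=
  GRing.isLinear.Build R M M *:%R (rho a b) (proj1 rho_gl a b).

Fact factor_is_linear A k a b : linear (factor A k a b).
Proof.
move=> e x y; apply/funext => q; case: k => [l|] /=; last exact: linearP.
rewrite !(addrfctE, scalrfctE) /actF; case: (A l); case: ifP => _.
- by [].
- by rewrite scaler0 addr0.
- by rewrite opprD scalerN.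
- by rewrite scaler0 addr0.
Qed.
HB.instance Definition _ A k a b :=
  GRing.isLinear.Build R (Tens N M n) (Tens N M n) *:%R (factor A k a b)
    (factor_is_linear A k a b).

Definition factor_lin A k a b : {linear Tens N M n -> Tens N M n} :=
  factor A k a b.

Lemma rho_actF A l a b c d x :
  (fun q => rho a b (actF A l c d x q)) = actF A l c d (fun q => rho a b (x q)).
Proof.
apply/funext => q; rewrite /actF.
by case: (A l); case: ifP; rewrite ?raddf0 // raddfN.
Qed.

Lemma actF_comm A k l a b c d x : k != l ->
  actF A k a b (actF A l c d x) = actF A l c d (actF A k a b x).
Proof.
move=> kl; have lk : l != k by rewrite eq_sym.
apply/funext => q; rewrite /actF !updq_neq // !(updqC _ _ _ kl).
by case: (A k); case: (A l); do 2!case: ifP; rewrite ?oppr0.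
Qed.

Lemma actF_gl A l a b c d x :
  actF A l a b (actF A l c d x) - actF A l c d (actF A l a b x) =
  (if b == c then actF A l a d x else 0) -
  (if d == a then actF A l c b x else 0).
Proof.
apply/funext => q; rewrite !addrfctE !opprfctE.
(* The conditionals are moved inside the functions so that the identity can be checked
   coefficientwise. *)
rewrite [if b == c then _ else _](_ : _ =
  fun q => if b == c then actF A l a d x q else 0); last by case: (b == c).
rewrite [if d == a then _ else _](_ : _ =
  fun q => if d == a then actF A l c b x q else 0); last by case: (d == a).
rewrite /actF !updq_id !updq_idem [c == b]eq_sym [a == d]eq_sym.
case: (A l); case: (b == c); case: (d == a); rewrite ?if_same ?oppr0 ?opprK //.
all: do ?[case: ifP => _]; rewrite ?oppr0 ?opprK ?sub0r ?subr0 ?addr0 ?add0r //.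
all: by rewrite addrC.
Qed.

Lemma factor_pairwise_gl A : pairwise_gl (factor_lin A).
Proof.
split=> [[l|] a b c d x|[k|] [l|] kl a b c d x] /=.
- exact: actF_gl.
- case: rho_gl => _ rel; apply/funext => q; rewrite addrfctE opprfctE rel.
  by case: (b == c); case: (d == a).
- exact: actF_comm.
- by rewrite rho_actF.
- by rewrite rho_actF.
- by [].
Qed.

Definition factor_lt (k l : option 'I_n) : bool :=
  if l is Some l' then (if k is Some k' then (k' < l')%N else true) else false.

Lemma factor_lt_irr : irreflexive factor_lt.
Proof. by case=> [l|] //=; rewrite ltnn. Qed.

Lemma factor_lt_trans : transitive factor_lt.
Proof. by move=> [l|] [k|] [m|] //=; apply: ltn_trans. Qed.

Lemma factor_lt_total k l : k != l -> factor_lt k l || factor_lt l k.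
Proof. by case: k l => [k|] [l|] //= kl; rewrite -neq_ltn. Qed.

Local Notation Om A := (Casimir (factor_lin A)).
Local Notation JM A l := (JucysMurphy (factor_lin A) factor_lt (Some l)).

(** The bridge from the concrete [yop] to the abstract theory: isolating the term [None] recovers
    the separate summand for M. *)
Lemma yopE A j x : yop rho A j x = JM A j x + (N%:R / 2%:R) *: x.
Proof.
apply/funext => q; rewrite addrfctE scalrfctE /yop; congr (_ + _).
rewrite /JucysMurphy big_option /= addrfctE !fct_sumE; congr (_ + _).
  by rewrite /Casimir fct_sumE; apply: eq_bigr => a _; rewrite fct_sumE.
apply: eq_bigr => k _; rewrite /Casimir fct_sumE.
by apply: eq_bigr => a _; rewrite fct_sumE.
Qed.

Lemma glactE A a b x : glact rho A a b x = diagonal (factor_lin A) predT a b x.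
Proof.
by apply/funext => q; rewrite /diagonal big_option /= addrfctE fct_sumE.
Qed.

Lemma yop_glact A j a b x :
  yop rho A j (glact rho A a b x) = glact rho A a b (yop rho A j x).
Proof.
rewrite !glactE !yopE [RHS]linearD linearZ; congr (_ + _) => /=.
by apply: JucysMurphy_diagonal => //;
  [exact: factor_pairwise_gl | exact: factor_lt_irr].
Qed.

Lemma yop_comm A i j x :
  yop rho A i (yop rho A j x) = yop rho A j (yop rho A i x).
Proof.
rewrite !yopE (linearD (JM A i)) (linearD (JM A j)) /= [JM A i (_ *: _)]linearZ.
rewrite [JM A j (_ *: _)]linearZ /= JucysMurphy_comm.
- by rewrite !scalerDr !addrA; congr (_ + _); rewrite addrAC.
- exact: factor_pairwise_gl.
- exact: factor_lt_irr.
- exact: factor_lt_trans.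
- exact: factor_lt_total.
Qed.

Lemma ord_eqE (i j : 'I_n) : (i == j) = (i == j :> nat).
Proof. by []. Qed.

(** * Flips of adjacent factors against the y_j *)

Section Flip.

Variables (A : {ffun 'I_n -> bool}) (p p' : 'I_n).
Hypothesis p'E : p' = p.+1 :> nat.

Local Notation swap := (swap_at p p').
Local Notation sA := [ffun j => A (swap j)].

Fact flip_at_is_linear : linear (flip_at p p' : Tens N M n -> Tens N M n).
Proof. by []. Qed.
HB.instance Definition _ := GRing.isLinear.Build R (Tens N M n) (Tens N M n)
  *:%R (flip_at p p') flip_at_is_linear.

Lemma consecutive_neq : p != p'.
Proof. by rewrite ord_eqE p'E; lia. Qed.

Lemma flip_at_factor k a b x : flip_at p p' (factor A k a b x) =
  factor sA (omap swap k) a b (flip_at p p' x).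
Proof. by case: k => [l|] //=; exact: flip_at_actF. Qed.

Lemma flip_at_Casimir k l x : flip_at p p' (Om A k l x) =
  Om sA (omap swap k) (omap swap l) (flip_at p p' x).
Proof.
rewrite /Casimir (linear_sum (flip_at p p')); apply: eq_bigr => a _ /=.
rewrite (linear_sum (flip_at p p')); apply: eq_bigr => b _ /=.
by rewrite !flip_at_factor.
Qed.

Lemma omap_swapK : involutive (omap swap).
Proof. by case=> //= l; rewrite swap_atK. Qed.

Lemma flip_at_glact a b x :
  flip_at p p' (glact rho A a b x) = glact rho sA a b (flip_at p p' x).
Proof.
rewrite !glactE /diagonal (linear_sum (flip_at p p')).
rewrite [RHS](reindex_inj (inv_inj omap_swapK)).
by apply: eq_bigr => k _ /=; rewrite flip_at_factor.
Qed.

(** The flip permutes the factors, so only the index set of the sum changes. The relations below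
    come from comparing this set with the one defining y at the swapped position. *)
Lemma flip_at_JucysMurphy j x : flip_at p p' (JM A j x) =
  \sum_(k | factor_lt (omap swap k) (Some j)) 
    Om sA k (Some (swap j)) (flip_at p p' x).
Proof.
rewrite /JucysMurphy (linear_sum (flip_at p p')).
rewrite [RHS](reindex_inj (inv_inj omap_swapK)).
by apply: eq_big => k; rewrite ?omap_swapK //= flip_at_Casimir.
Qed.

Lemma flip_at_yop_disjoint j x : j != p -> j != p' ->
  flip_at p p' (yop rho A j x) = yop rho sA j (flip_at p p' x).
Proof.
move=> jp jp'; rewrite !yopE linearD linearZ /= flip_at_JucysMurphy; congr (_ + _).
have -> : swap j = j by rewrite /swap_at (negPf jp) (negPf jp').
(* As [p] and [p'] are adjacent, both lie below [j] or neither does, so the swap preserves the index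
   set. *)
apply: eq_bigl => -[k|] //=; rewrite /swap_at.
rewrite !ord_eqE in jp jp'.
by have [->|_] := eqVneq k p; last have [->|//] := eqVneq k p'; lia.
Qed.

Lemma flip_at_yop_left x : flip_at p p' (yop rho A p x) =
  yop rho sA p' (flip_at p p' x) - Om sA (Some p) (Some p') (flip_at p p' x).
Proof.
rewrite !yopE linearD linearZ /= flip_at_JucysMurphy addrAC; congr (_ + _).
have -> : swap p = p' by rewrite /swap_at eqxx.
(* The sum at [p'] has exactly one surplus index, namely [p]; it is the subtracted Casimir term. *)
rewrite [in RHS]/JucysMurphy [in RHS](bigD1 (Some p)) /=; last by rewrite p'E.
rewrite addrAC subrr add0r; apply: eq_bigl => -[k|] //=.
rewrite /swap_at (inj_eq Some_inj).
have [->|] := eqVneq k p; last have [->|] := eqVneq k p'.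
all: by rewrite ?ord_eqE; lia.
Qed.

Lemma flip_at_yop_right x : flip_at p p' (yop rho A p' x) =
  yop rho sA p (flip_at p p' x) + Om sA (Some p) (Some p') (flip_at p p' x).
Proof.
rewrite !yopE linearD linearZ /= flip_at_JucysMurphy addrAC; congr (_ + _).
have -> : swap p' = p by rewrite /swap_at eqxx eq_sym (negPf consecutive_neq).
(* Here the transported sum is the one with a surplus index, [p']. Its Casimir term has the legs in
   reverse order, which [CasimirC] repairs. *)
rewrite (bigD1 (Some p')) /=; last first.
  by rewrite /swap_at eqxx eq_sym (negPf consecutive_neq) p'E.
rewrite addrC CasimirC; last 2 first.
- exact: factor_pairwise_gl.
- by rewrite (inj_eq Some_inj) eq_sym consecutive_neq.
congr (_ + _); apply: eq_bigl => -[k|] //=.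
rewrite /swap_at (inj_eq Some_inj).
have [->|] := eqVneq k p; last have [->|] := eqVneq k p'.
all: by rewrite ?ord_eqE; lia.
Qed.

End Flip.
Lemma Casimir_flip A p p' x : p != p' -> A p = A p' ->
  Om A (Some p) (Some p') x = flip_at p p' x.
Proof. exact: sum_actF_flip. Qed.

Lemma Casimir_cup A p p' x : p != p' -> A p != A p' ->
  Om A (Some p) (Some p') x = - cup_at p p' x.
Proof. exact: sum_actF_cup. Qed.

(** * Cups at adjacent factors of opposite sign against the y_j *)

Section Cup.

Variables (A B : {ffun 'I_n -> bool}) (p p' : 'I_n).
Hypotheses (p'E : p' = p.+1 :> nat).
Hypothesis AB : forall l, l != p -> l != p' -> A l = B l.
Hypotheses (App' : A p != A p') (Bpp' : B p != B p').

Let pp' : p != p' := consecutive_neq p'E.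

Fact cup_at_is_linear : linear (cup_at p p' : Tens N M n -> Tens N M n).
Proof.
move=> e x y; apply/funext => q.
rewrite -[RHS]/(e *: cup_at p p' x q + cup_at p p' y q) /cup_at.
by case: ifP; rewrite ?scaler0 ?addr0 // scaler_sumr -big_split.
Qed.
HB.instance Definition _ := GRing.isLinear.Build R (Tens N M n) (Tens N M n)
  *:%R (cup_at p p') cup_at_is_linear.

Lemma cup_at_factor k a b x : k != Some p -> k != Some p' ->
  cup_at p p' (factor A k a b x) = factor B k a b (cup_at p p' x).
Proof.
case: k => [l|_ _] /=; first by move=> lp lp'; apply: cup_at_actF => //; exact: AB.
apply/funext => q; rewrite /cup_at; case: ifP => _; last by rewrite linear0.
by rewrite linear_sum.
Qed.

(** Either both of [p], [p'] take part, and their joint action is killed by the cup on either side,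
    or neither does. All other factors commute with the cup. *)
Lemma cup_at_diagonal P a b x : P (Some p) = P (Some p') ->
  cup_at p p' (diagonal (factor_lin A) P a b x) =
  diagonal (factor_lin B) P a b (cup_at p p' x).
Proof.
move=> Ppp'; have step (C : {ffun 'I_n -> bool}) y :
    C p != C p' -> diagonal (factor_lin C) P a b y =
    (if P (Some p) then actF C p a b y + actF C p' a b y else 0) +
    \sum_(k | P k && (k != Some p) && (k != Some p')) factor C k a b y.
  move=> Cpp'; rewrite /diagonal; case: ifP => Pp; last first.
    rewrite add0r; apply: eq_bigl => k; case Pk: (P k) => //=.
    by apply/esym/andP; split; apply: contraTneq Pk => ->; rewrite -?Ppp' Pp.
  rewrite (bigD1 (Some p)) //= (bigD1 (Some p')) ?addrA //=.
  by rewrite -Ppp' Pp eq_sym.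
rewrite !step // linearD /=; congr (_ + _).
  case: (P (Some p)); rewrite ?linear0 //.
  by rewrite cup_at_actF_pair // actF_cup_at_pair.
rewrite (linear_sum (cup_at p p')); apply: eq_bigr => k /andP[/andP[_ kp] kp'] /=.
by rewrite cup_at_factor.
Qed.

Lemma cup_at_glact a b x :
  cup_at p p' (glact rho A a b x) = glact rho B a b (cup_at p p' x).
Proof. by rewrite !glactE cup_at_diagonal. Qed.

Lemma cup_at_yop_disjoint j x : j != p -> j != p' ->
  cup_at p p' (yop rho A j x) = yop rho B j (cup_at p p' x).
Proof.
move=> jp jp'; rewrite !yopE linearD linearZ /= !JucysMurphyE; congr (_ + _).
rewrite (linear_sum (cup_at p p')); apply: eq_bigr => a _ /=.
rewrite (linear_sum (cup_at p p')); apply: eq_bigr => b _ /=.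
rewrite cup_at_diagonal; first by rewrite (cup_at_actF _ _ _ _ _ (AB jp jp')).
by rewrite /=; move: jp jp'; rewrite !ord_eqE; clear -p'E; lia.
Qed.

(** The factors before [p] pair with the joint action at [p] and [p'], which the cup annihilates.
    The remaining Casimir term is minus the cup, and the two shifts N/2 add up to [N], the loop
    value that cancels it after composing with the cup. *)
Lemma yop_consecutive (C : {ffun 'I_n -> bool}) x : C p != C p' ->
  yop rho C p x + yop rho C p' x =
  (\sum_a \sum_b diagonal (factor_lin C) (factor_lt^~ (Some p)) a b
     (actF C p b a x + actF C p' b a x)) + (N%:R *: x - cup_at p p' x).
Proof.
move=> Cpp'; rewrite !yopE.
have -> : \sum_a \sum_b diagonal (factor_lin C) (factor_lt^~ (Some p)) a b
    (actF C p b a x + actF C p' b a x) = JM C p x +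
    \sum_(k | factor_lt k (Some p)) Om C k (Some p') x.
  rewrite JucysMurphyE [X in _ + X]exchange_big -big_split; apply: eq_bigr => a _ /=.
  rewrite [X in _ + X]exchange_big -big_split; apply: eq_bigr => b _ /=.
  by rewrite linearD.
have -> : JM C p' x =
    \sum_(k | factor_lt k (Some p)) Om C k (Some p') x - cup_at p p' x.
  rewrite -(Casimir_cup _ pp' Cpp') /JucysMurphy (bigD1 (Some p)) /=; last first.
    by rewrite p'E.
  rewrite addrC; congr (_ + _); apply: eq_bigl => -[k|] //=.
  by rewrite (inj_eq Some_inj) ord_eqE p'E; clear; lia.
rewrite addrACA addrA -!addrA; congr (_ + (_ + _)).
rewrite addrC; congr (_ - _); rewrite -scalerDl; congr (_ *: _).
by field.
Qed.

Lemma cup_at_yop_consecutive x :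
  cup_at p p' (yop rho A p x + yop rho A p' x) = 0.
Proof.
rewrite yop_consecutive // linearD linearB linearZ /= cup_atK // subrr addr0.
rewrite (linear_sum (cup_at p p')) big1 // => a _ /=.
rewrite (linear_sum (cup_at p p')) big1 // => b _ /=.
rewrite cup_at_diagonal; last by rewrite /= p'E; clear; lia.
by rewrite cup_at_actF_pair // linear0.
Qed.

Lemma yop_consecutive_cup_at x :
  yop rho B p (cup_at p p' x) + yop rho B p' (cup_at p p' x) = 0.
Proof.
rewrite yop_consecutive // cup_atK // subrr addr0.
rewrite big1 // => a _; rewrite big1 // => b _.
by rewrite actF_cup_at_pair // linear0.
Qed.

End Cup.

(** * Reduction of the loop relations to the scalars omega_k *)

Section Slice.

Variables (A : {ffun 'I_n -> bool}) (p p' : 'I_n).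
Hypotheses (p0 : p = 0 :> nat) (pp' : p != p') (Ap : A p).

(** All indices of [q] outside [p] and [p'] are frozen, which leaves an element of M tensor V tensor
    V^* when the signs at [p], [p'] are 1 and -1. *)
Definition slice q x : Tens N M 2 :=
  fun w => x (updq (updq q p (w ord0)) p' (w ord_max)).

Lemma slice_cup_at q x :
  slice q (cup_at p p' x) = coev (\sum_k x (updq (updq q p k) p' k)).
Proof.
apply/funext => w; rewrite /slice /cup_at /coev updq_neq // !updq_id.
case: ifP => // _; apply: eq_bigr => k _; congr x.
by rewrite (updqC _ _ _ pp') updq_idem updqC 1?eq_sym // updq_idem.
Qed.

Lemma cup_at_slice q x :
  cup_at p p' x q = if q p == q p' then ev (slice q x) else 0.
Proof.
rewrite /cup_at /ev /slice; case: ifP => // _.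
by apply: eq_bigr => k _; rewrite !ffunE.
Qed.

Lemma slice_yop q x : slice q (yop rho A p x) = yop rho A2 ord0 (slice q x).
Proof.
apply/funext => w; rewrite /slice /yop; congr (_ + _ + _).
- apply: eq_bigr => a _; apply: eq_bigr => b _; congr rho.
  have A2T : A2 ord0 by rewrite ffunE.
  rewrite /actF Ap A2T updq_neq // updq_id.
  rewrite updq_id updq_neq //; case: ifP => // _; congr x.
  by rewrite updqC 1?eq_sym // updq_idem.
(* No tensor factor precedes the first one, so both inner Casimir sums are empty. *)
- by rewrite !big_pred0 // => k; rewrite ?p0 ltn0.
Qed.

Lemma slice_iter_yop q k x :
  slice q (iter k (yop rho A p) x) = iter k (yop rho A2 ord0) (slice q x).
Proof. by elim: k => //= k <-; rewrite slice_yop. Qed.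

Variable omega : nat -> R.
Hypothesis omegaP : is_omega rho omega.

Lemma cup_at_iter_yop k x :
  cup_at p p' (iter k (yop rho A p) (cup_at p p' x)) = omega k *: cup_at p p' x.
Proof.
apply/funext => q; rewrite cup_at_slice slice_iter_yop slice_cup_at omegaP.
by rewrite scalrfctE /cup_at; case: ifP; rewrite ?scaler0.
Qed.

End Slice.

(** Coevaluation followed by evaluation is a closed loop. The scalars are compared through their
    action on [m], since on a zero module they need not coincide. *)
Lemma is_omega0 omega (m : M) : is_omega rho omega -> omega 0%N *: m = N%:R *: m.
Proof.
move=> /(_ 0%N m) <-; rewrite /= /ev /coev.
under eq_bigr => k _ do rewrite !ffunE eqxx.
by rewrite sumr_const card_ord scaler_nat.
Qed.

End Factors.

(** * Specialisation to adjacent pairs and verification of the relations *)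

Section Generators.

Variables (n : nat) (i : 'I_n.-1).

Lemma posRE : posR i = (posL i).+1 :> nat.
Proof. by []. Qed.

Lemma swapA_notin (A : {ffun 'I_n -> bool}) j :
  j != posL i -> j != posR i -> swapA i A j = A j.
Proof. by move=> jl jr; rewrite ffunE /swap_pos (negPf jl) (negPf jr). Qed.

Lemma swapA_posL (A : {ffun 'I_n -> bool}) : swapA i A (posL i) = A (posR i).
Proof. by rewrite ffunE /swap_pos eqxx. Qed.

Lemma swapA_posR (A : {ffun 'I_n -> bool}) : swapA i A (posR i) = A (posL i).
Proof.
by rewrite ffunE /swap_pos eqxx eq_sym (negPf (consecutive_neq posRE)).
Qed.

Lemma swapA_eq (A : {ffun 'I_n -> bool}) : A (posL i) = A (posR i) -> swapA i A = A.
Proof.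
move=> Ai; apply/ffunP => j; rewrite ffunE /swap_pos.
by case: eqP => [->|_]; last case: eqP => [->|].
Qed.

Lemma swapA_neq (A B : {ffun 'I_n -> bool}) :
  A (posL i) != A (posR i) -> B = A \/ B = swapA i A ->
  B (posL i) != B (posR i).
Proof. by move=> Ai [->|->] //; rewrite swapA_posL swapA_posR eq_sym. Qed.

Lemma swapA_agree (A B : {ffun 'I_n -> bool}) : B = A \/ B = swapA i A ->
  forall l, l != posL i -> l != posR i -> A l = B l.
Proof. by move=> [->|->] // l ll lr; rewrite swapA_notin. Qed.

End Generators.

Lemma far_pos n (i j : 'I_n.-1) : far i j ->
  [/\ posL i <> posL j, posL i <> posR j, posR i <> posL j & posR i <> posR j].
Proof. by rewrite /far => ij; split=> /(congr1 val) /=; lia. Qed.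

(** Neighbouring pairs share one position, so their relations live on three distinct positions. *)
Lemma next_pos n (i j : 'I_n.-1) : Defs.next i j ->
  [/\ posL j = posR i, posL i <> posR i, posL i <> posR j & posR i <> posR j].
Proof.
rewrite /Defs.next /= => ij; split; first exact: val_inj.
all: by move=> /(congr1 val) /=; lia.
Qed.

Theorem mainTheorem14 (R : numClosedFieldType) (N : nat) (M : lmodType R)
    (rho : 'I_N -> 'I_N -> M -> M) (omega : nat -> R) (r t : nat) :
  gl_module rho -> highest_weight_module rho -> is_omega rho omega ->
  ops_are_homs rho r t /\ VB_relations rho r t omega.
Proof.
move=> rho_gl _ omegaP.
have flipE i : flip i = flip_at (posL i) (posR i) :> (Tens N M (r + t) -> _) by [].
have cupE i : cup i = cup_at (posL i) (posR i) :> (Tens N M (r + t) -> _) by [].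
have LR (i : 'I_(r + t).-1) : posL i != posR i by exact: consecutive_neq.
have sAE i A : swapA i A = [ffun j => A (swap_at (posL i) (posR i) j)] by [].
split=> A _.
  split=> [i a b x q|]; first by rewrite flipE flip_at_glact.
  split=> [i Ai|j a b x q]; last by rewrite yop_glact.
  have cup_hom B : B = A \/ B = swapA i A -> is_hom rho A B (cup i).
    move=> BA a b x q; rewrite cupE.
    by rewrite (cup_at_glact rho_gl (posRE i) (swapA_agree BA) Ai
      (swapA_neq Ai BA)).
  by split; apply: cup_hom; [left | right].
do !apply: conj.
- by move=> i x q; rewrite flipE flip_atK.
- move=> i j x q /far_pos[ll lr rl rr].
  by rewrite !flipE (flip_flip_far ll lr rl rr).
- move=> i j x q /next_pos[e ll lr rr].
  by rewrite !flipE e flip_at_braid.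
- by move=> i j x q ji jr; rewrite flipE flip_at_yop_disjoint.
(* The loop yields [N] for every pair, and [is_omega0] exchanges it for [omega 0]. *)
- by move=> i x q Ai; rewrite !cupE cup_atK // [RHS](is_omega0 _ omegaP).
- move=> i k x q i0 Ai Air; rewrite !cupE.
  by rewrite (cup_at_iter_yop (i0 : posL i = 0 :> nat) (LR i) Ai omegaP).
- move=> i j x q /far_pos[ll lr rl rr] _.
  by rewrite !flipE !cupE (flip_cup_far ll lr rl rr).
- move=> i j x q /far_pos[ll lr rl rr] _ _.
  by rewrite !cupE (cup_cup_far ll lr rl rr).
- move=> i j B x q jl jr Ai BA; rewrite cupE.
  by rewrite (cup_at_yop_disjoint _ _ (swapA_agree BA)) // (swapA_neq Ai BA).
- by move=> i j x q; rewrite yop_comm.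
- by move=> i x q _; rewrite flipE cupE flip_at_cup.
- by move=> i x q _; rewrite flipE cupE cup_at_flip.
- move=> i j x q /next_pos[e ll lr rr] _.
  by rewrite !flipE !cupE e flip_cup_cup.
- move=> i j x q /next_pos[e ll lr rr] _.
  by rewrite !flipE !cupE e cup_cup_flip.
- move=> i j x q /next_pos[e ll lr rr] _.
  (* Symmetry of cups and flips in their positions lets the three positions be read from right to
     left, giving the mirror image of a relation already shown. *)
  rewrite !flipE !cupE e !(cup_atC (posR i) (posR j)) (cup_atC (posL i) (posR i)).
  rewrite (flip_atC (posR i) (posR j)) (flip_atC (posL i) (posR i)).
  by rewrite (cup_cup_flip (nesym rr) (nesym lr) (nesym ll)).
- move=> i j x q /next_pos[e ll lr rr] _.
  rewrite !flipE !cupE e !(cup_atC (posR i) (posR j)) (cup_atC (posL i) (posR i)).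
  rewrite (flip_atC (posR i) (posR j)) (flip_atC (posL i) (posR i)).
  by rewrite (flip_cup_cup (nesym rr) (nesym lr) (nesym ll)).
- move=> i j x q /next_pos[e ll lr rr] _.
  rewrite !cupE e !(cup_atC (posR i) (posR j)) (cup_atC (posL i) (posR i)).
  by rewrite (cup_cup_cup (nesym rr) (nesym lr) (nesym ll)).
- move=> i j x q /next_pos[e ll lr rr] _.
  by rewrite !cupE e (cup_cup_cup ll lr rr).
(* For equal signs the swapped object is [A] itself and the Casimir correction is the flip, whose
   square is the identity. *)
- move=> i x q Ai; have sA := swapA_eq Ai.
  rewrite flipE (flip_at_yop_left rho_gl _ (posRE i)) -sAE sA.
  by rewrite Casimir_flip // flip_atK addrfctE opprfctE addrAC subrr add0r.
- move=> i x q Ai; have sA := swapA_eq Ai.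
  rewrite flipE (flip_at_yop_right rho_gl _ (posRE i)) -sAE sA.
  by rewrite Casimir_flip // flip_atK addrfctE addrAC subrr add0r.
(* For opposite signs the correction is minus the cup, which absorbs the flip. *)
- move=> i x q Ai; have sAi := swapA_neq Ai (or_intror erefl).
  rewrite flipE (flip_at_yop_left rho_gl _ (posRE i)) -sAE.
  rewrite Casimir_cup // opprK cup_at_flip // addrfctE.
  by rewrite addrAC subrr add0r.
- move=> i x q Ai; have sAi := swapA_neq Ai (or_intror erefl).
  rewrite flipE (flip_at_yop_right rho_gl _ (posRE i)) -sAE.
  rewrite Casimir_cup // cup_at_flip // addrfctE.
  by rewrite addrAC subrr add0r.
- move=> i x q Ai; rewrite cupE.
  by rewrite (cup_at_yop_consecutive rho_gl (posRE i) (fun _ _ _ => erefl) Ai Ai).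
- move=> i B x q Ai BA; rewrite cupE.
  exact: (congr1 (@^~ q) (yop_consecutive_cup_at rho_gl (posRE i)
    (swapA_neq Ai BA) x)).
Qed.
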